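(* Let $d\ge 2$ be an integer, and let $\varepsilon>0$ and $C>0$ be fixed. Then, as $q\to\infty$ through prime powers, $$|\Pi_{\alpha,\beta}(E)|=\frac{|E|^3}{q^2}\,(1+o(1))$$ in each of the following two situations: (i) $\alpha,\beta\in\mathbb{F}_q^*$ and $E\subset\mathbb{F}_q^d$ satisfies $|E|\ge C\,q^{\frac{d+1}{2}+\varepsilon}$; (ii) $\alpha,\beta\in\mathbb{F}_q$ are arbitrary (possibly zero) and $E\subset\mathbb{F}_q^d$ satisfies $|E|\ge C\,q^{\frac{d+2}{2}+\varepsilon}$. Here $o(1)$ denotes a quantity tending to $0$ as $q\to\infty$, uniformly in $E,\alpha,\beta$: for every $\delta>0$ there is $q_0=q_0(d,\varepsilon,C,\delta)$ such that for all prime powers $q\ge q_0$ and all $E,\alpha,\beta$ as in (i) or (ii), $\bigl|\,|\Pi_{\alpha,\beta}(E)|-|E|^3/q^2\,\bigr|\le\delta\,|E|^3/q^2$.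
   Context: $\mathbb{F}_q$ is the finite field with $q$ elements, $\mathbb{F}_q^*=\mathbb{F}_q\setminus\{0\}$, and for $x,y\in\mathbb{F}_q^d$, $x\cdot y=\sum_{i=1}^d x_iy_i$. For $E\subset\mathbb{F}_q^d$ and $\alpha,\beta\in\mathbb{F}_q$, $$\Pi_{\alpha,\beta}(E)=\{(x,y,z)\in E\times E\times E : x\cdot y=\alpha,\ x\cdot z=\beta\}.$$ *)

(* Defs.v *)
From HB Require Import structures.
From mathcomp Require Import all_boot all_order all_algebra.

Set Implicit Arguments.
Unset Strict Implicit.
Unset Printing Implicit Defensive.

Import GRing.Theory.
Local Open Scope ring_scope.

Definition dotp (F : finFieldType) (d : nat) (x y : 'rV[F]_d) : F :=
  \sum_(i < d) x ord0 i * y ord0 i.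

Definition Pi2 (F : finFieldType) (d : nat) (alpha beta : F)
    (E : {set 'rV[F]_d}) : {set 'rV[F]_d * 'rV[F]_d * 'rV[F]_d} :=
  [set t | let: (x, y, z) := t in
    [&& x \in E, y \in E, z \in E, dotp x y == alpha & dotp x z == beta]].

(* Main.v *)
(* Write N_a(x) = #{y in E : x.y = a}, n = |E|, so that
   |Pi_{alpha,beta}(E)| = sum_{x in E} N_alpha(x) N_beta(x). The variance
   sum_x (N_a(x) - n/q)^2, taken over the whole space, is computed by counting,
   for y, z in E, the x with x.y = x.z = a. There are q^(d-2) of them when y and
   z are independent; dependent pairs contribute at most n q^(d-1) if a <> 0
   (then only y = z matters) and 2 n q^d in general. The variance is therefore
   O(n q^(d-1)), resp. O(n q^d), which is o(n^3/q^2) under the size assumption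
   on E, and the product sum is controlled by AM-GM. *)
Require Import Defs.
From mathcomp Require Import all_boot all_order all_algebra.
From mathcomp Require Import all_classical all_reals all_analysis.
From mathcomp Require Import ring lra.

Set Implicit Arguments.
Unset Strict Implicit.
Unset Printing Implicit Defensive.

Import Order.TTheory GRing.Theory Num.Theory.
Local Open Scope ring_scope.

(** * Solution counts of one or two linear equations over a finite field *)

(** Full column rank makes [x *m A] surjective, and translation by [(c - b) *m pinvmx A] maps the
    fibre over [b] onto the one over [c]. So [#|F| ^ k] fibres of equal size partition the space.
    The product form avoids the truncated exponent [d - k]. *)
Lemma card_mulmx_fiber (F : finFieldType) (d k : nat) (A : 'M[F]_(d, k))
    (b : 'rV[F]_k) : row_full A ->
  (#|[pred x : 'rV[F]_d | x *m A == b]| * #|F| ^ k = #|F| ^ d)%N.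
Proof.
move=> fullA; pose fib c := #|[pred x : 'rV[F]_d | x *m A == c]|.
have fibE c : fib c = fib b.
  have Mx0 : (c - b) *m pinvmx A *m A = c - b.
    by rewrite mulmxKpV // submx_full.
  rewrite /fib -(fintype.card_image (addIr ((c - b) *m pinvmx A))
    [pred x | x *m A == b]).
  apply: eq_card => x; rewrite !inE; apply/eqP/fintype.imageP => [xA|[y]].
    exists (x - (c - b) *m pinvmx A); last by rewrite subrK.
    by rewrite inE mulmxBl Mx0 xA opprB addrC subrK.
  by rewrite inE => /eqP yA ->; rewrite /= (mulmxDl y) Mx0 yA addrC subrK.
rewrite -[in RHS](mul1n d) -card_mx -[RHS]sum1_card.
rewrite (partition_big (fun x => x *m A) xpredT) //=.
rewrite (eq_bigr (fun=> fib b)) => [|c _]; last first.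
  by rewrite -(fibE c) /fib -sum1_card; apply: eq_bigl => x; rewrite inE.
by rewrite sum_nat_const card_mx mul1n mulnC.
Qed.

Lemma dotp_mulmx (F : finFieldType) (d : nat) (x y : 'rV[F]_d) :
  x *m y^T = (dotp x y)%:M.
Proof.
apply/matrixP => i j; rewrite !ord1 !mxE eqxx mulr1n /dotp.
by apply: eq_bigr => l _; rewrite mxE.
Qed.

Lemma card_dotp (F : finFieldType) (d : nat) (y : 'rV[F]_d.+1) (a : F) :
  y != 0 -> #|[pred x | dotp x y == a]| = (#|F| ^ d)%N.
Proof.
move=> y0; apply/eqP; rewrite -(eqn_pmul2r (m := #|F|)); last first.
  exact: ltnW (card_finNzRing_gt1 F).
rewrite -expnSr -(@card_mulmx_fiber _ _ _ y^T a%:M); last first.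
  by rewrite /row_full mxrank_tr rank_rV y0.
rewrite expn1; apply/eqP; congr (_ * _)%N; apply: eq_card => x; rewrite !inE.
rewrite dotp_mulmx; apply/eqP/eqP => [->//|/matrixP/(_ ord0 ord0)].
by rewrite !mxE !eqxx.
Qed.

Lemma card_dotp2 (F : finFieldType) (d : nat) (y z : 'rV[F]_d.+2) (a b : F) :
    y != 0 -> ~~ (z <= y)%MS ->
  #|[pred x | (dotp x y == a) && (dotp x z == b)]| = (#|F| ^ d)%N.
Proof.
move=> y0 zy; apply/eqP; rewrite -(eqn_pmul2r (m := #|F| ^ 2)); last first.
  by rewrite expn_gt0; apply/orP; left; exact: ltnW (card_finNzRing_gt1 F).
rewrite -expnD addn2.
rewrite -(@card_mulmx_fiber _ _ _ (col_mx y z)^T (row_mx a%:M b%:M)); last first.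
  rewrite /row_full mxrank_tr eqn_leq rank_leq_row /=.
  (* Strict inclusion of row spaces raises the rank, from 1 to 2 here. *)
  have : (y < col_mx y z)%MS.
    by rewrite ltmxE -!addsmxE addsmxSl addsmx_sub negb_and zy orbT.
  by move/rank_ltmx; rewrite rank_rV y0.
apply/eqP; congr (_ * _)%N; apply: eq_card => x; rewrite !inE.
rewrite tr_col_mx mul_mx_row !dotp_mulmx.
apply/andP/eqP => [[/eqP-> /eqP->]//|/eq_row_mx[]].
by do 2![move=> /matrixP/(_ ord0 ord0); rewrite !mxE !eqxx /= !mulr1n => ->].
Qed.

Lemma dotpZr (F : finFieldType) (d : nat) (c : F) (x y : 'rV[F]_d) :
  dotp x (c *: y) = c * dotp x y.
Proof.
by rewrite /dotp mulr_sumr; apply: eq_bigr => i _; rewrite mxE mulrCA.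
Qed.

Lemma dotp0r (F : finFieldType) (d : nat) (x : 'rV[F]_d) : dotp x 0 = 0.
Proof. by rewrite -(scale0r 0) dotpZr mul0r. Qed.

(** If [z = c *: y], a common solution [x] gives [c * a = a], hence [c = 1]. So dependent pairs off
    the diagonal have no solution. *)
Lemma card_dotp2_nonzero (F : finFieldType) (d : nat) (y z : 'rV[F]_d.+2)
    (a : F) : a != 0 ->
  (#|[pred x | (dotp x y == a) && (dotp x z == a)]|
     <= #|F| ^ d + (z == y) * #|F| ^ d.+1)%N.
Proof.
move=> a0; have [->|y0] := eqVneq y 0.
  by rewrite eq_card0 // => x; rewrite !inE dotp0r eq_sym (negPf a0).
have [->|zy] := eqVneq z y.
  rewrite mul1n -(@card_dotp _ _ y a y0); apply: leq_trans (leq_addl _ _).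
  by apply/subset_leq_card/fintype.subsetP => x; rewrite !inE => /andP[].
have [/sub_rVP[c zE]|zNy] := boolP (z <= y)%MS; last first.
  by rewrite card_dotp2// leq_addr.
rewrite eq_card0 // => x; rewrite !inE zE dotpZr.
apply: contraNF zy => /andP[/eqP->]; rewrite -subr_eq0 -{2}(mul1r a) -mulrBl.
by rewrite mulf_eq0 (negPf a0) orbF subr_eq0 zE => /eqP->; rewrite scale1r.
Qed.

(** Degenerate pairs are bounded crudely: by the whole space if [y = 0], by one hyperplane if [z] is
    a multiple of a nonzero [y]. Indicators put all cases in one bound that can be summed over
    pairs. *)
Lemma card_dotp2_le (F : finFieldType) (d : nat) (y z : 'rV[F]_d.+2) (a b : F) :
  (#|[pred x | (dotp x y == a) && (dotp x z == b)]|
     <= #|F| ^ d + (y == 0)%R * #|F| ^ d.+2 + (z <= y)%MS * #|F| ^ d.+1)%N.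
Proof.
have [->|y0] := eqVneq y 0.
  rewrite mul1n (leq_trans (max_card _)) // card_mx mul1n.
  by rewrite -addnA addnCA leq_addr.
have [zy|zNy] := boolP (z <= y)%MS; last by rewrite card_dotp2 // !addn0.
rewrite mul1n -(@card_dotp _ _ y a y0) mul0n addn0.
apply: leq_trans (leq_addl _ _).
by apply/subset_leq_card/fintype.subsetP => x; rewrite !inE => /andP[].
Qed.

Lemma card_line (F : finFieldType) (d : nat) (y : 'rV[F]_d) :
  (#|[pred z : 'rV[F]_d | (z <= y)%MS]| <= #|F|)%N.
Proof.
apply: leq_trans (leq_image_card (fun c : F => c *: y) xpredT).
apply/subset_leq_card/fintype.subsetP => z; rewrite inE => /sub_rVP[c ->].
exact: fintype.image_f.
Qed.

(** * Moments and variance of the hyperplane counts *)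

(** This is N_a(x), taken in [R] so that the mean n/q can be subtracted, and written with indicators
    so that sums can be exchanged. *)
Definition hyp_count (R : realType) (F : finFieldType) (d : nat)
    (E : {set 'rV[F]_d}) (a : F) (x : 'rV[F]_d) : R :=
  \sum_(y in E) (dotp x y == a)%:R.

Lemma card_Pi2 (R : realType) (F : finFieldType) (d : nat) (alpha beta : F)
    (E : {set 'rV[F]_d}) :
  #|Pi2 alpha beta E|%:R
    = \sum_(x in E) hyp_count R E alpha x * hyp_count R E beta x.
Proof.
transitivity (\sum_x \sum_y \sum_z
    (((x, y, z) \in Pi2 alpha beta E)%:R : R)).
  rewrite -sum1_card natr_sum big_mkcond pair_bigA pair_bigA.
  by apply: eq_bigr => -[[x y] z] _ /=; case: ifP.
rewrite [RHS]big_mkcond; apply: eq_bigr => x _.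
have [xE|xE] := ifP; last first.
  by rewrite big1 // => y _; rewrite big1 // => z _; rewrite inE xE.
rewrite /hyp_count big_distrlr [RHS]big_mkcond; apply: eq_bigr => y _.
have [yE|yE] := ifP; last first.
  by rewrite big1 // => z _; rewrite inE xE yE.
rewrite [RHS]big_mkcond; apply: eq_bigr => z _; rewrite inE xE yE /=.
by case: (z \in E); rewrite //= -natrM mulnb.
Qed.

(* Every nonzero y lies on exactly q^d hyperplanes; [- 1] accounts for y = 0. *)
Lemma hyp_count_moment1 (R : realType) (F : finFieldType) (d : nat)
    (E : {set 'rV[F]_d.+1}) (a : F) :
  (#|E|%:R - 1) * #|F|%:R ^+ d <= \sum_x hyp_count R E a x.
Proof.
rewrite /hyp_count exchange_big /=.
have -> : #|E|%:R = \sum_(y in E) 1%R :> R by rewrite sumr_const.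
apply: (@le_trans _ _ (\sum_(y in E) (1 - (y == 0)%:R) * #|F|%:R ^+ d)).
  rewrite -mulr_suml ler_wpM2r ?exprn_ge0 // sumrB lerD2l lerN2.
  rewrite big_mkcond (bigD1 0) //= big1 ?addr0 => [|y /negPf->].
    by case: ifP; rewrite ?eqxx.
  by case: ifP.
apply: ler_sum => y _; have [->|y0] := eqVneq y 0.
  by rewrite subrr mul0r sumr_ge0.
rewrite subr0 mul1r -natrX -(@card_dotp _ _ y a y0) -sum1_card natr_sum.
rewrite big_mkcond ler_sum // => x _ ; rewrite inE.
by case: (_ == _).
Qed.

Lemma hyp_count_moment2 (R : realType) (F : finFieldType) (d : nat)
    (E : {set 'rV[F]_d}) (a : F) :
  \sum_x hyp_count R E a x ^+ 2 = \sum_(y in E) \sum_(z in E)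
    #|[pred x | (dotp x y == a) && (dotp x z == a)]|%:R.
Proof.
under eq_bigr => x _ do rewrite /hyp_count expr2 big_distrlr /=.
rewrite exchange_big; apply: eq_bigr => y _; rewrite exchange_big.
apply: eq_bigr => z _; rewrite -sum1_card natr_sum [RHS]big_mkcond.
by apply: eq_bigr => x _; rewrite inE -natrM mulnb; case: (_ && _).
Qed.

(** [K] is the excess caused by degenerate pairs, per element of [E]. After expanding the square,
    the terms n^2 q^d cancel; the remaining 2 n q^d comes from the [- 1] in the first moment. *)
Lemma hyp_count_variance (R : realType) (F : finFieldType) (d : nat)
    (E : {set 'rV[F]_d.+2}) (a : F) (K : R) :
    \sum_(y in E) \sum_(z in E)
       #|[pred x | (dotp x y == a) && (dotp x z == a)]|%:R
      <= #|E|%:R * (#|E|%:R * #|F|%:R ^+ d + K) ->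
  \sum_x (hyp_count R E a x - #|E|%:R / #|F|%:R) ^+ 2
    <= #|E|%:R * (K + 2 * #|F|%:R ^+ d).
Proof.
move=> HK; set n : R := #|E|%:R; set q : R := #|F|%:R.
have q0 : q != 0 by rewrite pnatr_eq0 -lt0n; exact: ltnW (card_finNzRing_gt1 F).
have q_gt0 : 0 < q by rewrite lt0r q0 ler0n.
have := @hyp_count_moment1 R F d.+1 E a; rewrite -/n -/q => M1.
have M2 : \sum_x hyp_count R E a x ^+ 2 <= n * (n * q ^+ d + K).
  by rewrite hyp_count_moment2.
under eq_bigr => x _ do rewrite sqrrB.
rewrite big_split sumrB /= sumrMnl -mulr_suml sumr_const card_mx mul1n.
rewrite -[X in _ + X]mulr_natl natrX -/q.
have -> : q ^+ d.+2 * (n / q) ^+ 2 = n ^+ 2 * q ^+ d by rewrite !exprS; field.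
(* The first moment enters with a minus sign, so its lower bound suffices. *)
have : n / q * ((n - 1) * q ^+ d.+1) <= n / q * \sum_x hyp_count R E a x.
  by rewrite ler_wpM2l // divr_ge0 // ltW.
have -> : n / q * ((n - 1) * q ^+ d.+1) = n * (n - 1) * q ^+ d.
  by rewrite exprS; field.
nra.
Qed.

Lemma hyp_count_variance_nonzero (R : realType) (F : finFieldType) (d : nat)
    (E : {set 'rV[F]_d.+2}) (a : F) : a != 0 ->
  \sum_(x in E) (hyp_count R E a x - #|E|%:R / #|F|%:R) ^+ 2
    <= 4 * #|E|%:R * #|F|%:R ^+ d.+1.
Proof.
move=> a0; set n : R := #|E|%:R; set q : R := #|F|%:R.
have q1 : 1 <= q by rewrite ler1n ltnW ?card_finNzRing_gt1.
apply: (@le_trans _ _ (\sum_x (hyp_count R E a x - n / q) ^+ 2)).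
  rewrite [leLHS]big_mkcond ler_sum // => x _.
  by case: ifP => // _; exact: sqr_ge0.
(* Here [K] is [q ^+ d.+1], the cost of the single degenerate choice z = y. *)
apply: (@le_trans _ _ (n * (q ^+ d.+1 + 2 * q ^+ d))); last first.
  have : 0 <= n * q ^+ d by rewrite mulr_ge0 // exprn_ge0.
  by rewrite exprS; nra.
apply: hyp_count_variance; rewrite -/n -/q.
have -> : n * (n * q ^+ d + q ^+ d.+1)
    = \sum_(y in E) (n * q ^+ d + q ^+ d.+1).
  by rewrite sumr_const -[RHS]mulr_natl.
apply: ler_sum => y yE.
apply: (@le_trans _ _ (\sum_(z in E) (q ^+ d + (z == y)%:R * q ^+ d.+1))).
  apply: ler_sum => z _; rewrite -!natrX -natrM -natrD ler_nat.
  exact: card_dotp2_nonzero.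
rewrite big_split /= sumr_const -[X in X + _]mulr_natl lerD2l -mulr_suml.
rewrite (bigD1 y) //= eqxx big1 ?addr0 ?mul1r // => z /andP[_ /negPf->].
by [].
Qed.

Lemma hyp_count_variance_le (R : realType) (F : finFieldType) (d : nat)
    (E : {set 'rV[F]_d.+2}) (a : F) :
  \sum_(x in E) (hyp_count R E a x - #|E|%:R / #|F|%:R) ^+ 2
    <= 4 * #|E|%:R * #|F|%:R ^+ d.+2.
Proof.
set n : R := #|E|%:R; set q : R := #|F|%:R.
have q1 : 1 <= q by rewrite ler1n ltnW ?card_finNzRing_gt1.
have q0 : 0 <= q by exact: le_trans q1.
have qd : 0 <= q ^+ d by exact: exprn_ge0.
apply: (@le_trans _ _ (\sum_x (hyp_count R E a x - n / q) ^+ 2)).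
  rewrite [leLHS]big_mkcond ler_sum // => x _.
  by case: ifP => // _; exact: sqr_ge0.
(* Here [K] is [2 * q ^+ d.+2]: one half pays for the n pairs with y = 0, the other for the at most
   q multiples z of each y, at [q ^+ d.+1] apiece. *)
apply: (@le_trans _ _ (n * (2 * q ^+ d.+2 + 2 * q ^+ d))); last first.
  have : q ^+ d <= q ^+ d.+2 by apply: ler_weXn2l => //; rewrite leqW.
  have : 0 <= n by exact: ler0n.
  by nra.
apply: hyp_count_variance; rewrite -/n -/q.
apply: (@le_trans _ _ (\sum_(y in E)
    ((n * q ^+ d + q ^+ d.+2) + (y == 0)%:R * (n * q ^+ d.+2)))).
  apply: ler_sum => y _.
  apply: (@le_trans _ _ (\sum_(z in E) ((q ^+ d + (y == 0)%:R * q ^+ d.+2)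
      + (z <= y)%MS%:R * q ^+ d.+1))).
    apply: ler_sum => z _; rewrite -!natrX -!natrM -!natrD ler_nat.
    exact: card_dotp2_le.
  rewrite big_split /= sumr_const -[X in X + _]mulr_natl -mulr_suml.
  have : (\sum_(z in E) (z <= y)%MS%:R : R) <= q.
    apply: (@le_trans _ _ #|[pred z : 'rV[F]_d.+2 | (z <= y)%MS]|%:R).
      rewrite -sum1_card natr_sum [leLHS]big_mkcond [leRHS]big_mkcond.
      by apply: ler_sum => z _; rewrite inE; case: ifP; case: (z <= y)%MS.
    by rewrite ler_nat card_line.
  move/(ler_wpM2r (exprn_ge0 d.+1 q0)); rewrite -exprS -/n.
  lra.
rewrite big_split /= sumr_const -[X in X + _]mulr_natl -mulr_suml.
have : (\sum_(y in E) (y == 0)%:R : R) <= 1.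
  rewrite big_mkcond (bigD1 0) //= big1 ?addr0 => [|y /negPf->].
    by case: ifP; rewrite ?eqxx.
  by case: ifP.
have : 0 <= n * q ^+ d.+2 by rewrite mulr_ge0 ?exprn_ge0.
by rewrite -/n; nra.
Qed.

(** * From two variances to the sum of products *)

(** With f = a + u and g = a + v, the error is a u + a v + u v. The weight [t] bounds the linear
    terms by a [t]-fraction of the main term plus variances scaled by [t^-1], so [t] can be fixed
    first and [eta] made small afterwards. *)
Lemma sum_mul_deviation (R : realType) (I : finType) (A : {set I})
    (f g : I -> R) (a t eta : R) : 0 < t ->
    \sum_(i in A) (f i - a) ^+ 2 <= eta * (#|A|%:R * a ^+ 2) ->
    \sum_(i in A) (g i - a) ^+ 2 <= eta * (#|A|%:R * a ^+ 2) ->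
  `|\sum_(i in A) f i * g i - #|A|%:R * a ^+ 2|
    <= (t + eta * (t^-1 + 1)) * (#|A|%:R * a ^+ 2).
Proof.
move=> t0.
have -> : #|A|%:R * a ^+ 2 = \sum_(i in A) a ^+ 2.
  by rewrite sumr_const mulr_natl.
move=> Vf Vg.
rewrite -sumrB; apply: le_trans (ler_norm_sum _ _ _) _.
apply: (@le_trans _ _ (\sum_(i in A) (t * a ^+ 2
    + (t^-1 + 1) / 2 * ((f i - a) ^+ 2 + (g i - a) ^+ 2)))).
  apply: ler_sum => i _.
  set u := f i - a; set v := g i - a.
  (* AM-GM: [2 a w <= t a^2 + w^2 / t] and [2 u v <= u^2 + v^2] *)
  have -> : f i * g i - a ^+ 2 = a * u + a * v + u * v by rewrite /u /v; ring.
  have au w : `|a * w| <= (t * a ^+ 2 + t^-1 * w ^+ 2) / 2.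
    have tV : 0 < t^-1 by rewrite invr_gt0.
    have -> : t * a ^+ 2 + t^-1 * w ^+ 2 = t^-1 * ((t * a) ^+ 2 + w ^+ 2).
      by field; rewrite gt_eqF.
    have -> : a * w = t^-1 * (t * a * w) by field; rewrite gt_eqF.
    rewrite normrM (gtr0_norm tV) -[leRHS]mulrA (ler_wpM2l (ltW tV)) // ler_norml.
    have := sqr_ge0 (t * a - w); have := sqr_ge0 (t * a + w); nra.
  have uv : `|u * v| <= (u ^+ 2 + v ^+ 2) / 2.
    by rewrite ler_norml; have := sqr_ge0 (u - v); have := sqr_ge0 (u + v); nra.
  have := au u; have := au v.
  have := ler_normD (a * u + a * v) (u * v); have := ler_normD (a * u) (a * v).
  lra.
rewrite big_split /= -[X in X + _]mulr_sumr -[X in _ + X]mulr_sumr big_split /=.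
have tV : 0 < t^-1 by rewrite invr_gt0.
nra.
Qed.

(** * Real powers and the size assumption on E *)

Lemma powR_unbounded (R : realType) (e K : R) : 0 < e ->
  exists N : nat, forall m : nat, (N <= m)%N -> K <= m%:R `^ e.
Proof.
move=> e0; exists (Num.truncn (`|K| `^ e^-1)).+1 => m Nm.
apply: le_trans (ler_norm K) _.
have -> : `|K| = (`|K| `^ e^-1) `^ e.
  by rewrite -powRrM mulVf ?powRr1 // lt0r_neq0.
apply: ge0_ler_powR; rewrite ?nnegrE ?powR_ge0 ?ler0n ?(ltW e0) //.
by rewrite ltW // (lt_le_trans (truncnS_gt _)) // ler_nat.
Qed.

Lemma sqr_powR_half (R : realType) (x e : R) (k : nat) : 0 < x ->
  (x `^ (k%:R / 2 + e)) ^+ 2 = x ^+ k * x `^ (2 * e).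
Proof.
move=> x0; rewrite -powR_mulrn ?powR_ge0 // -powRrM -powR_mulrn ?ltW //.
rewrite -powRD; last by rewrite (gt_eqF x0) implybT.
by congr (_ `^ _); field.
Qed.

(** Squaring the size assumption gives n^2 >= C^2 q^(k+2) q^(2 eps), and the last factor absorbs 4 /
    (eta C^2); hence 4 q^k <= eta n^2 / q^2. A variance of order n q^k thus calls for the size
    exponent (k+2)/2. *)
Lemma variance_small (R : realType) (q n eps C eta V : R) (k : nat) :
    0 < q -> 0 <= n -> 0 < C -> 0 < eta ->
    4 / (eta * C ^+ 2) <= q `^ (2 * eps) ->
    C * q `^ (k.+2%:R / 2 + eps) <= n -> V <= 4 * n * q ^+ k ->
  V <= eta * (n * (n / q) ^+ 2).
Proof.
move=> q0 n0 C0 eta0 Hw Hn HV; apply: le_trans HV _.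
have C2 : 0 < eta * C ^+ 2 by rewrite mulr_gt0 ?exprn_gt0.
rewrite ler_pdivrMr // in Hw.
have n2 : C ^+ 2 * (q ^+ k.+2 * q `^ (2 * eps)) <= n ^+ 2.
  rewrite -sqr_powR_half // -exprMn ler_sqr ?nnegrE //.
  by rewrite mulr_ge0 ?powR_ge0 // ltW.
have -> : eta * (n * (n / q) ^+ 2) = n * (eta * n ^+ 2 / q ^+ 2).
  by field; rewrite gt_eqF.
rewrite [leLHS](_ : _ = n * (4 * q ^+ k)); last ring.
apply: (ler_wpM2l n0); rewrite ler_pdivlMr ?exprn_gt0 //.
rewrite -mulrA -exprD addn2.
apply: le_trans (ler_wpM2l (ltW eta0) n2).
rewrite [leRHS](_ : _ = q `^ (2 * eps) * (eta * C ^+ 2) * q ^+ k.+2); last ring.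
by rewrite ler_wpM2r // exprn_ge0 // ltW.
Qed.

Theorem theorem6 (R : realType) (d : nat) (eps C : R)
    (hd : (2 <= d)%N) (heps : 0 < eps) (hC : 0 < C) :
  forall delta : R, 0 < delta ->
  exists q0 : nat, forall F : finFieldType, (q0 <= #|F|)%N ->
  forall (alpha beta : F) (E : {set 'rV[F]_d}),
    let q : R := #|F|%:R in
    let n : R := #|E|%:R in
    (alpha != 0 /\ beta != 0 /\ C * q `^ ((d%:R + 1) / 2 + eps) <= n) \/
    C * q `^ ((d%:R + 2) / 2 + eps) <= n ->
    `| #|Pi2 alpha beta E|%:R - n ^+ 3 / q ^+ 2 | <= delta * (n ^+ 3 / q ^+ 2).
Proof.
move=> delta delta0; case: d hd => [|[|d]] // _.
(* Half of [delta] is spent on [t]; [eta] is chosen so that [eta * (t^-1 + 1)] equals the other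
   half. *)
pose t := delta / 2; pose eta := t / (t^-1 + 1).
have t0 : 0 < t by rewrite divr_gt0.
have tV : 0 < t^-1 + 1 by rewrite addr_gt0 // invr_gt0.
have eta0 : 0 < eta by rewrite divr_gt0.
have eps2 : 0 < 2 * eps by rewrite mulr_gt0.
(* The threshold depends only on [delta], [C] and [eps], which gives the uniformity in [E], [alpha]
   and [beta]. *)
have [q0 Hq0] := powR_unbounded (4 / (eta * C ^+ 2)) eps2.
exists q0 => F /Hq0 Hw alpha beta E q n Hn.
have q_gt0 : 0 < q by rewrite ltr0n ltnW ?card_finNzRing_gt1.
have -> : n ^+ 3 / q ^+ 2 = n * (n / q) ^+ 2 by field; rewrite gt_eqF.
have deltaE : delta = t + eta * (t^-1 + 1).
  by rewrite /eta divfK ?gt_eqF // /t; lra.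
rewrite card_Pi2 deltaE.
have HV a : (a == alpha) || (a == beta) ->
    \sum_(x in E) (hyp_count R E a x - n / q) ^+ 2 <= eta * (n * (n / q) ^+ 2).
  (* The dimension is now [d.+2]: the nonzero case uses [variance_small] with k = d + 1, the general
     case with k = d + 2, matching the two size exponents. *)
  move=> aE; case: Hn => [[alpha0 [beta0 Hn]]|Hn].
    apply: (variance_small q_gt0 _ hC eta0 Hw) (hyp_count_variance_nonzero _ _ _).
    - exact: ler0n.
    - by rewrite -natr1.
    - by case/orP: aE => /eqP->.
  apply: (variance_small q_gt0 _ hC eta0 Hw) (hyp_count_variance_le _ _ _).
  - exact: ler0n.
  - by rewrite -addn2 natrD.
by apply: sum_mul_deviation => //; apply: HV; rewrite eqxx ?orbT.
Qed.
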